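(* Let $G$ be a finite simple graph consisting of $m\ge 1$ connected components $G_1,\ldots,G_m$, let $n=|V(G)|$, and for $1\le i\le m$ let $b_i=n-|V(G_i)|$. Then $$\widetilde{D}(G,x)=\Big(\sum_{i=1}^m x^{b_i}\,\widetilde{D}(G_i,x)\Big)-(m-1)x^n,$$ where $\widetilde{D}$ denotes the outer-connected domination polynomial.
   Context: All graphs are finite, simple, and have nonempty vertex set. A set $S\subseteq V(G)$ is a dominating set of $G$ if every vertex of $V(G)\setminus S$ is adjacent to at least one vertex of $S$. A set $S\subseteq V(G)$ is an outer-connected dominating set (ocd-set) of $G$ if $S$ is a dominating set of $G$ and either $S=V(G)$ or the subgraph of $G$ induced by $V(G)\setminus S$ is connected. The outer-connected domination number $\widetilde{\gamma}_c(G)$ is the minimum cardinality of an ocd-set of $G$. Let $\widetilde{d}(G,i)$ be the number of ocd-sets of $G$ of cardinality $i$. The outer-connected domination polynomial of $G$ is $\widetilde{D}(G,x)=\sum_{i=\widetilde{\gamma}_c(G)}^{|V(G)|}\widetilde{d}(G,i)\,x^i$. *)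

(* Defs.v *)
From HB Require Import structures.
From mathcomp Require Import all_boot all_order all_algebra.

Set Implicit Arguments.
Unset Strict Implicit.
Unset Printing Implicit Defensive.

Import GRing.Theory.
Local Open Scope ring_scope.

Record sgraph := SGraph {
  vertex :> finType;
  edge : rel vertex;
  edge_sym : symmetric edge;
  edge_irrefl : irreflexive edge }.

Section Graph.
Variable G : sgraph.
Implicit Types S : {set G}.

Definition induced_edge S : rel {x : G | x \in S} :=
  fun x y => edge (val x) (val y).

Lemma induced_edge_sym S : symmetric (@induced_edge S).
Proof. by move=> x y; apply: edge_sym. Qed.

Lemma induced_edge_irrefl S : irreflexive (@induced_edge S).
Proof. by move=> x; apply: edge_irrefl. Qed.

Definition induced S : sgraph :=
  SGraph (@induced_edge_sym S) (@induced_edge_irrefl S).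

(* A record of type sgraph may have no vertex; such a graph is not connected. *)
Definition connected : bool :=
  (0 < #|G|)%N && [forall x : G, forall y : G, connect (@edge G) x y].

Definition components : {set {set G}} :=
  equivalence_partition (connect (@edge G)) [set: G].

Definition dominating S : bool :=
  [forall x : G, (x \notin S) ==> [exists y in S, edge x y]].

End Graph.

Section OuterConnectedDomination.
Variable G : sgraph.
Implicit Types S : {set G}.

Definition ocd_set S : bool :=
  dominating S && ((S == [set: G]) || connected (induced (~: S))).

(* The starting point setT of the arg min is always an ocd-set (ocd_setT),    *)
(* so that this is a genuine minimum.                                         *)
Definition ocd_number : nat :=
  #|[arg min_(S < [set: G] | ocd_set S) #|S|]|.

Lemma ocd_setT : ocd_set [set: G].
Proof. by rewrite /ocd_set eqxx andbT; apply/forallP => x; rewrite inE. Qed.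

Definition ocd_count (i : nat) : nat :=
  #|[set S : {set G} | ocd_set S & #|S| == i]|.

Definition ocd_poly : {poly int} :=
  \sum_(ocd_number <= i < #|G|.+1) (ocd_count i)%:R *: 'X^i.

End OuterConnectedDomination.

(* Main.v *)
(** An ocd-set [S] other than the whole vertex set has a nonempty connected
    complement, which therefore lies in exactly one component [V i]; then
    [S :&: V i] is a proper ocd-set of that component, and this is a bijection
    that lowers the cardinality by [n - #|V i|]. The whole vertex set
    contributes ['X^n] once on the left but [m] times on the right. *)
Require Import Defs.
From HB Require Import structures.
From mathcomp Require Import all_boot all_order all_algebra.

Import GRing.Theory.
Local Open Scope ring_scope.

Lemma ocd_number_le (G : sgraph) (S : {set G}) :
  ocd_set S -> (ocd_number G <= #|S|)%N.
Proof.
rewrite /ocd_number; case: arg_minnP; first exact: ocd_setT.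
by move=> T _ min_T /min_T.
Qed.

(** Grouping the ocd-sets by cardinality gives the coefficients. Starting the sum at [ocd_number G]
    loses no set, by minimality; [inord] never truncates, since a cardinality is at most [#|G|]. *)
Lemma ocd_polyE (G : sgraph) :
  ocd_poly G = \sum_(S : {set G} | ocd_set S) 'X^#|S|.
Proof.
rewrite /ocd_poly big_geq_mkord.
rewrite (partition_big (fun S : {set G} => inord #|S| : 'I_#|G|.+1)
           (fun i : 'I_#|G|.+1 => (ocd_number G <= i)%N)) /=; last first.
  by move=> S /ocd_number_le; rewrite inordK // ltnS max_card.
apply: eq_bigr => i _.
rewrite (eq_big (fun S => S \in [set S | ocd_set S & #|S| == i])
                (fun=> 'X^i)).
- by rewrite sumr_const scaler_nat.
- by move=> S; rewrite inE -val_eqE /= inordK // ltnS max_card.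
by move=> S /andP[_ /eqP <-]; rewrite inordK // ltnS max_card.
Qed.

Lemma ocd_poly_proper (G : sgraph) :
  ocd_poly G =
    'X^#|G| + \sum_(S : {set G} | ocd_set S && (S != [set: G])) 'X^#|S|.
Proof. by rewrite ocd_polyE (bigD1 [set: G]) ?ocd_setT //= cardsT. Qed.

(** Only [f] has to preserve edges: [g] merely picks preimages, and [f] maps a path between these to
    a path between the given vertices. *)
Lemma connected_hom (G H : sgraph) (f : G -> H) (g : H -> G) :
  cancel g f -> {homo f : x y / edge x y} -> connected G -> connected H.
Proof.
move=> gK f_edge /andP[/card_gt0P[x0 _] /forallP conG]; apply/andP; split.
  by apply/card_gt0P; exists (f x0).
apply/forallP => x; apply/forallP => y.
have /connectP[p] := forallP (conG (g x)) (g y).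
move=> gp gyE; apply/connectP; exists (map f p); last first.
  by rewrite -(gK y) gyE -[in RHS](gK x) last_map.
by rewrite -(gK x); apply: homo_path gp => u v; apply: f_edge.
Qed.

Section Component.

Set Implicit Arguments.
Unset Strict Implicit.

Variables (G : sgraph) (V : {set G}).
Implicit Types (S : {set G}) (T : {set induced V}).

(** This is [T] together with all vertices outside [V]. Written with complements, it shows that [T]
    and [extend T] leave out the same vertices. *)
Definition extend T : {set G} := ~: [set val x | x in ~: T].
Definition trace S : {set induced V} := [set x | val x \in S].

Lemma extendC T : ~: extend T = [set val x | x in ~: T].
Proof. exact: setCK. Qed.

Lemma in_extend T (x : induced V) : (val x \in extend T) = (x \in T).
Proof. by rewrite inE mem_imset ?inE ?negbK //; apply: val_inj. Qed.

Lemma extendCP T x :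
  reflect (exists2 u : induced V, u \notin T & x = val u) (x \notin extend T).
Proof.
rewrite -in_setC extendC; apply: (iffP imsetP) => -[u].
  by rewrite inE; exists u.
by exists u; rewrite ?inE.
Qed.

Lemma extendK : cancel extend trace.
Proof. by move=> T; apply/setP => x; rewrite inE in_extend. Qed.

Lemma traceK S : ~: S \subset V -> extend (trace S) = S.
Proof.
move=> /subsetP sSV; apply/setP => x; apply/negb_inj.
apply/extendCP/idP => [[u]|xS]; first by rewrite inE => uS ->.
have xV : x \in V by apply: sSV; rewrite inE.
by exists (exist _ x xV); rewrite ?inE.
Qed.

Lemma extendC_sub T : ~: extend T \subset V.
Proof. by rewrite extendC; apply/subsetP => _ /imsetP[u _ ->]; apply: valP. Qed.

Lemma card_extend T : #|extend T| = (#|G| - #|induced V| + #|T|)%N.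
Proof.
have := cardsC (extend T); rewrite extendC.
have leV : (#|induced V| <= #|G|)%N by apply: (leq_card val); apply: val_inj.
rewrite card_imset; last exact: val_inj.
have := cardsC T => eT eE; apply/eqP.
by rewrite -(eqn_add2r #|~: T|) -addnA eT eE subnK.
Qed.

Lemma extend_eqT T : (extend T == [set: G]) = (T == [set: induced V]).
Proof.
rewrite -(inj_eq (@setC_inj _)) extendC setCT imset_eq0.
by rewrite -[in RHS](inj_eq (@setC_inj _)) setCT.
Qed.

(** The vertices left to dominate are the same on both sides and lie in [V]. As [V] is closed under
    adjacency, so do all their neighbours. *)
Lemma dominating_extend T :
  (forall x y, edge x y -> x \in V -> y \in V) ->
  dominating (extend T) = dominating T.
Proof.
move=> V_closed; apply/forallP/forallP => [dom x|dom x]; apply/implyP.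
  rewrite -in_extend => /(implyP (dom _))/existsP[y /andP[yS exy]].
  have yV := V_closed _ _ exy (valP x).
  apply/existsP; exists (exist _ y yV : induced V).
  by rewrite -in_extend yS.
move=> /extendCP[u uT ->{x}].
have /existsP[y /andP[yT euy]] := implyP (dom u) uT.
by apply/existsP; exists (val y); rewrite in_extend yT.
Qed.

(** Both graphs have the same vertices and edges up to the encoding: one is a subtype of [G], the
    other a subtype of a subtype. The maps [f] and [g] only repackage vertices. *)
Lemma connected_extend T :
  connected (induced (~: extend T)) = connected (induced (~: T)).
Proof.
have inV (x : induced (~: extend T)) : val x \in V.
  exact: subsetP (extendC_sub T) _ (valP x).
have inT (x : induced (~: extend T)) :
    (exist _ (val x) (inV x) : induced V) \in ~: T.
  by rewrite inE -in_extend -in_setC; exact: (valP x).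
have inE' (x : induced (~: T)) : val (val x) \in ~: extend T.
  by rewrite inE in_extend -in_setC; exact: (valP x).
pose f x : induced (~: T) :=
  exist (fun u => u \in ~: T) _ (inT x).
pose g x : induced (~: extend T) :=
  exist (fun u => u \in ~: extend T) _ (inE' x).
apply/idP/idP; [apply: (@connected_hom _ _ f g)|apply: (@connected_hom _ _ g f)].
- by move=> x; do 2 apply: val_inj.
- by [].
- by move=> x; apply: val_inj.
- by [].
Qed.

Lemma sum_ocd_extend :
  (forall x y, edge x y -> x \in V -> y \in V) ->
  \sum_(S : {set G} | [&& ocd_set S, S != [set: G] & ~: S \subset V]) 'X^#|S|
  = 'X^(#|G| - #|induced V|) *
    \sum_(T | ocd_set T && (T != [set: induced V])) 'X^#|T| :> {poly int}.
Proof.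
move=> V_closed; rewrite (reindex_onto extend trace) /=; last first.
  by move=> S /and3P[_ _ /traceK].
rewrite mulr_sumr; apply: eq_big => [T|T _]; last by rewrite -exprD card_extend.
rewrite extendK eqxx andbT extendC_sub andbT extend_eqT.
by rewrite /ocd_set extend_eqT connected_extend dominating_extend.
Qed.

End Component.

Section Components.

Set Implicit Arguments.
Unset Strict Implicit.

Variable G : sgraph.
Implicit Type V : {set G}.

Lemma connect_equiv : {in [set: G] & &, equivalence_rel (connect (@edge G))}.
Proof.
move=> x y z _ _ _; split=> [|xy]; first exact: connect0.
by apply: same_connect => //; apply: sym_connect_sym; apply: edge_sym.
Qed.

Lemma component_connect V x y :
  V \in components G -> connect (@edge G) x y -> x \in V -> y \in V.
Proof.
move=> /imsetP[z _ ->]; rewrite !inE /= => xy zx; exact: connect_trans zx xy.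
Qed.

Lemma connected_induced V x y :
  connected (induced V) -> x \in V -> y \in V -> connect (@edge G) x y.
Proof.
move=> /andP[_ /forallP con] xV yV.
have connect_val (u v : induced V) : connect (@edge G) (val u) (val v).
  have /connectP[p e_p ->] := forallP (con u) v.
  by apply/connectP; exists (map val p); rewrite ?last_map // path_map.
exact: (connect_val (exist _ x xV) (exist _ y yV)).
Qed.

End Components.

Theorem theorem2 (G : sgraph) (m : nat) (V : 'I_m -> {set G})
    (m_ge1 : (1 <= m)%N)
    (V_inj : injective V)
    (V_components : [set V i | i in 'I_m] = components G) :
  ocd_poly G =
    (\sum_(i < m) 'X^(#|G| - #|induced (V i)|) * ocd_poly (induced (V i)))
    - (m%:R - 1) *: 'X^#|G|.
Proof.
have V_comp i : V i \in components G by rewrite -V_components imset_f.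
have /and3P[/eqP covV tiV _] := equivalence_partitionP (@connect_equiv G).
(* Stated as an equality of booleans so that, for fixed [S], a sum over the indices [j] with
   [~: S \subset V j] collapses to one term. *)
have unique_component (S : {set G}) : ocd_set S -> S != [set: G] ->
    exists i, forall j, (~: S \subset V j) = (j == i).
  case/andP=> _ /orP[->//|con] S_neqT.
  have [x xS] : exists x, x \in ~: S.
    by apply/set0Pn; rewrite -setCT (inj_eq (@setC_inj _)).
  have : x \in cover (components G) by rewrite covV.
  case/bigcupP=> W; rewrite -V_components => /imsetP[i _ ->] xVi.
  (* If [V j] also contains [~: S], it shares [x] with [V i]; disjointness of distinct components
     and [V_inj] then force [j = i]. *)
  exists i => j; apply/idP/eqP => [/subsetP sVj|->].
    apply: V_inj; apply/eqP/negPn/negP => neqV.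
    have /pred0P/(_ x) := trivIsetP tiV _ _ (V_comp j) (V_comp i) neqV.
    by rewrite /= sVj ?xVi.
  apply/subsetP => y yS; apply: component_connect (V_comp i) _ xVi.
  exact: connected_induced con xS yS.
have card_induced i : (#|induced (V i)| <= #|G|)%N.
  by apply: (leq_card val); apply: val_inj.
(* In each summand the full set of the component contributes ['X^(n - #|V i|) * 'X^#|V i| = 'X^n],
   where [n] is [#|G|]. *)
under eq_bigr => i _.
  rewrite ocd_poly_proper mulrDr -exprD subnK // -sum_ocd_extend; last first.
    by move=> x y xy; apply: component_connect (V_comp i) (connect1 xy).
  over.
(* Of the [m] copies of ['X^#|G|], the correction removes all but one, which matches the full vertex
   set on the left. *)
rewrite big_split /= sumr_const card_ord scalerBl scale1r scaler_nat.
rewrite opprB [_ *+ m + _]addrC addrA addrAC addrK addrC ocd_poly_proper; congr (_ + _).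
(* With [S] summed outermost, each proper ocd-set is counted once, at the index of the component
   containing its complement. *)
rewrite (exchange_big_dep (fun S => ocd_set S && (S != [set: G]))) /=; last first.
  by move=> i S _ /and3P[-> ->].
apply: eq_bigr => S /andP[ocdS S_neqT].
have [i def_i] := unique_component S ocdS S_neqT.
by rewrite (big_pred1 i) // => j; rewrite ocdS S_neqT def_i.
Qed.
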